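(* Let $(B,Y)$ be a quantum $Y$-seed with $B=(b_{ij})_{i,j=1}^n$ and $Y=(Y_1,\dots,Y_n)$, with associated data $\mathbf{d}=(d_1,\dots,d_n)$, $\mathbf{r}=(r_1,\dots,r_n)$, $\mathbf{z}=(z_{i,s})$. Let $k\in\{1,\dots,n\}$ and let $(B',Y')=\mu_k(B,Y)$ be the $(\mathbf{d},\mathbf{z})$-mutation of $(B,Y)$ at $k$, with $B'=(b'_{ij})_{i,j=1}^n$ and $Y'=(Y'_1,\dots,Y'_n)$. Then for all $i,j\in\{1,\dots,n\}$, $$Y'_iY'_j=q^{2r_jd_jb'_{ji}}\,Y'_jY'_i.$$
   Context: Data. $B=(b_{ij})_{i,j=1}^n$ is a skew-symmetrizable integer matrix; $\mathbf{d}=(d_1,\dots,d_n)$ is an $n$-tuple of positive integers; $\mathbf{r}=(r_1,\dots,r_n)$ is an $n$-tuple of positive integers with $r_id_ib_{ij}=-r_jd_jb_{ji}$ for all $i,j$. $q$ is a formal variable and $q_i:=q^{r_id_i}$. $F$ is a field, and $\mathbf{z}=(z_{i,s})_{i=1,\dots,n;\,s=1,\dots,d_i-1}$ is a collection of elements of $F$ satisfying the reciprocity condition $z_{i,s}=z_{i,d_i-s}$; one sets $z_{i,0}=z_{i,d_i}=1$. Quantum $Y$-seed. $Y=(Y_1,\dots,Y_n)$ is an $n$-tuple of noncommuting (invertible) formal variables with commutation relations $Y_iY_j=q^{2r_jd_jb_{ji}}Y_jY_i$; $q$ and the elements of $F$ commute with all $Y_i$. The pair $(B,Y)$ is called a quantum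 $Y$-seed. Expressions involving inverses are taken in the skew field of fractions of the $F(q)$-algebra generated by the $Y_i^{\pm1}$ subject to these relations. Mutation. For an integer $a$, $[a]_+=a$ if $a>0$ and $0$ if $a\le0$; $\mathrm{sgn}(a)=+1,0,-1$ according to $a>0$, $a=0$, $a<0$. The $(\mathbf{d},\mathbf{z})$-mutation (generalized mutation) $(B',Y')=\mu_k(B,Y)$ at $k$ is defined by $$b'_{ij}=\begin{cases}-b_{ij} & i=k\text{ or }j=k,\\ b_{ij}+d_k\bigl([-b_{ik}]_+b_{kj}+b_{ik}[b_{kj}]_+\bigr) & i,j\neq k,\end{cases}$$ $$Y'_i=\begin{cases}Y_k^{-1} & i=k,\\ \displaystyle q_i^{\,b_{ik}d_k[\varepsilon b_{ki}]_+}\,Y_i\,Y_k^{\,d_k[\varepsilon b_{ki}]_+}\prod_{m=1}^{|b_{ki}|}\left(\sum_{s=0}^{d_k}z_{k,s}\,q_k^{-\varepsilon\,\mathrm{sgn}(b_{ki})(2m-1)s}\,Y_k^{\varepsilon s}\right)^{-\mathrm{sgn}(b_{ki})} & i\neq k,\end{cases}$$ where $\varepsilon\in\{+1,-1\}$; the right-hand side does not depend on the choice of $\varepsilon$. Empty products equal $1$. *)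

(* Defs.v *)
From HB Require Import structures.
From mathcomp Require Import all_boot all_order all_algebra.

Set Implicit Arguments.
Unset Strict Implicit.
Unset Printing Implicit Defensive.

Import Order.TTheory GRing.Theory Num.Theory.
Local Open Scope ring_scope.

(* The field F(q) of rational functions over F; [qvar] is q. *)
Notation ratfun F := {fraction {poly F}}.

Definition qvar (F : fieldType) : ratfun F := tofrac 'X.

Definition cst (F : fieldType) (c : F) : ratfun F := tofrac c%:P.

(* [a]_+ *)
Definition pos_part (a : int) : int := if 0 < a then a else 0.

(* B is skew-symmetrizable, with the positive integers s_i as symmetrizer. *)
Definition skew_symmetrizer (n : nat) (s : 'I_n -> nat) (B : 'M[int]_n) : Prop :=
  (forall i, (0 < s i)%N) /\
  (forall i j, (s i)%:Z * B i j = - ((s j)%:Z * B j i)).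

Definition reciprocal (F : fieldType) (n : nat) (d : 'I_n -> nat)
    (z : 'I_n -> nat -> F) : Prop :=
  forall i s, (0 < s < d i)%N -> z i s = z i (d i - s)%N.

(* Only the values z i s with 0 < s < d i are data; the others are never used,
   since z_{i,0} = z_{i,d_i} = 1 is imposed here. *)
Definition zcoef (F : fieldType) (n : nat) (d : 'I_n -> nat)
    (z : 'I_n -> nat -> F) (i : 'I_n) (s : nat) : F :=
  if (s == 0%N) || (s == d i) then 1 else z i s.

Section QuantumTorus.

Variables (F : fieldType) (n : nat) (d r : 'I_n -> nat) (B : 'M[int]_n).

Definition q_commuting (A : algType (ratfun F)) (u : 'I_n -> A) : Prop :=
  forall i j,
    u i * u j = (qvar F ^ (2 * (r j)%:Z * (d j)%:Z * B j i)) *: (u j * u i).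

Definition torus_relations (A : algType (ratfun F)) (u v : 'I_n -> A) : Prop :=
  [/\ forall i, u i * v i = 1, forall i, v i * u i = 1 & q_commuting u].

(* T is the F(q)-algebra presented by the generators y_i and yV_i = y_i^-1
   subject to the torus relations (universal property of the presentation). *)
Definition is_quantum_torus (T : algType (ratfun F)) (y yV : 'I_n -> T) : Prop :=
  torus_relations y yV /\
  forall (A : algType (ratfun F)) (u v : 'I_n -> A), torus_relations u v ->
    exists f : {lrmorphism T -> A},
      (forall i, f (y i) = u i) /\
      (forall g : {lrmorphism T -> A}, (forall i, g (y i) = u i) -> g =1 f).

(* D is a skew field of (right) fractions of T, along the embedding iota. *)
Definition is_skew_field_of_fractions (T : algType (ratfun F))
    (D : unitAlgType (ratfun F)) (iota : {lrmorphism T -> D}) : Prop :=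
  [/\ forall x : D, x != 0 -> x \is a GRing.unit,
      injective iota
    & forall x : D, exists a b : T, b != 0 /\ x = iota a / iota b].

(* The Y_i are formal variables: they are the images of the generators of the
   quantum torus in its skew field of fractions D. *)
Definition quantum_Y_seed (D : unitAlgType (ratfun F)) (Y : 'I_n -> D) : Prop :=
  skew_symmetrizer (fun i => (r i * d i)%N) B /\
  exists (T : algType (ratfun F)) (y yV : 'I_n -> T) (iota : {lrmorphism T -> D}),
    [/\ is_quantum_torus y yV,
        is_skew_field_of_fractions iota
      & forall i, Y i = iota (y i)].

End QuantumTorus.

Section Mutation.

Variables (F : fieldType) (n : nat) (d r : 'I_n -> nat) (z : 'I_n -> nat -> F).
Variable D : unitAlgType (ratfun F).

(* q_i = q ^ (r_i d_i) *)
Definition qi (i : 'I_n) : ratfun F := qvar F ^+ (r i * d i).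

Definition mutation_B (k : 'I_n) (B : 'M[int]_n) : 'M[int]_n :=
  \matrix_(i, j)
    if (i == k) || (j == k) then - B i j
    else B i j + (d k)%:Z * (pos_part (- B i k) * B k j
                             + B i k * pos_part (B k j)).

(* The sum over s in the m-th factor of the mutation rule; all the factors are
   Laurent polynomials in Y_k, so their order in the product is immaterial. *)
Definition mutation_factor (eps : int) (k i : 'I_n) (B : 'M[int]_n)
    (Y : 'I_n -> D) (m : nat) : D :=
  \sum_(0 <= s < (d k).+1)
    (cst (zcoef d z k s)
      * qi k ^ (- eps * sgz (B k i) * (2 * m%:Z - 1) * s%:Z))
    *: Y k ^ (eps * s%:Z).

Definition mutation_Y (eps : int) (k : 'I_n) (B : 'M[int]_n)
    (Y : 'I_n -> D) (i : 'I_n) : D :=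
  if i == k then (Y k)^-1
  else qi i ^ (B i k * (d k)%:Z * pos_part (eps * B k i))
       *: (Y i * Y k ^ ((d k)%:Z * pos_part (eps * B k i))
           * \prod_(1 <= m < `|B k i|%N.+1)
               mutation_factor eps k i B Y m ^ (- sgz (B k i))).

Definition mutation (eps : int) (k : 'I_n) (S : 'M[int]_n * ('I_n -> D)) :
    'M[int]_n * ('I_n -> D) :=
  (mutation_B k S.1, mutation_Y eps k S.1 S.2).

End Mutation.

(* Main.v *)
Require Import Defs.
From HB Require Import structures.
From mathcomp Require Import all_boot all_order all_algebra.
From mathcomp Require Import ring zify.

Set Implicit Arguments.
Unset Strict Implicit.
Unset Printing Implicit Defensive.

Import Order.TTheory GRing.Theory Num.Theory.
Local Open Scope ring_scope.

(** The mutated variable Y'_i (i <> k) is, up to a scalar, U_i * P_i, where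
U_i = Y_i Y_k^(a_i) with a_i = d_k [eps b_ki]_+ is a monomial and P_i is a
product of factors of the form f(c^e W)^(+1 or -1), with W = Y_k^eps,
c = q_k^(-eps), f(X) = \sum_s z_{k,s} X^s and e odd.  Since moving U_j to the
left through a function of W replaces W by c^(2 b_kj) W, both
U_i P_i U_j P_j and U_j P_j U_i P_i can be brought to the form monomials first,
functions of W last, and the claim splits in two.

The monomials commute up to a power of q computed from the torus relations;
skew-symmetry of r_i d_i b_ij together with [a]_+ - [-a]_+ = a turns its
exponent into 2 r_j d_j b'_ji for either value of eps
([mutation_B_weighted]).

The functions of W must agree:
P_i(c^(2 b_kj) W) P_j(W) = P_j(c^(2 b_ki) W) P_i(W).  Formally
P_i(W) = H(c^(2 b_ki) W) / H(W) for a solution H (a quantum dilogarithm) of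
H(c^2 W) = H(W) / f(c W), so that both sides are
H(c^(2 b_ki + 2 b_kj) W) / H(W).  Only the quotients of values of H belong to
the skew field; their chain rule, a cocycle identity in the exponent, is proved
by induction on it from the difference equation ([shift_product_cocycle]).

All of this requires the factors f(c^e W) to be invertible, hence nonzero in
the skew field of fractions.  Their constant term is 1, and the powers of W are
linearly independent: the presentation of the torus provides an endomorphism
multiplying every generator by q, hence acting on the powers of W by distinct
eigenvalues ([const_coef_eq0], [torus_dilation], [seed_sum_unit]). *)

(** * Products of shifted factors *)

Section ShiftProduct.

Variables (R : unitRingType) (f : int -> R).

(** With [f e] standing for f(c^e W), this is the formal quotient
H(c^(e + 2b) W) / H(c^e W), where H(c^2 W) = H(W) / f(c W). *)
Definition shift_product (b e : int) : R :=
  \prod_(1 <= m < `|b|%N.+1) f (e + sgz b * (2 * m%:Z - 1)) ^ (- sgz b).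

Lemma shift_product_pos (n : nat) (e : int) :
  shift_product n%:Z e = \prod_(1 <= m < n.+1) (f (e + (2 * m%:Z - 1)))^-1.
Proof.
case: n => [|n]; first by rewrite /shift_product !big_geq.
rewrite /shift_product absz_nat gtr0_sgz //.
by under eq_bigr do rewrite mul1r exprN1.
Qed.

Lemma shift_product_neg (n : nat) (e : int) :
  shift_product (- n%:Z) e = \prod_(1 <= m < n.+1) f (e - (2 * m%:Z - 1)).
Proof.
case: n => [|n]; first by rewrite /shift_product !big_geq.
rewrite /shift_product abszN absz_nat ltr0_sgz ?oppr_lt0 //.
by under eq_bigr do rewrite mulN1r opprK expr1z.
Qed.

Hypothesis f_unit : forall e, f e \is a GRing.unit.

(** The difference equation of H.  For b >= 0 the step appends an inverse
factor; for b < 0 the factors carry exponent +1 and it cancels the last one. *)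
Lemma shift_productS (b e : int) :
  shift_product (b + 1) e = shift_product b e * (f (e + 2 * b + 1))^-1.
Proof.
case: b => n.
  rewrite -[Posz n + 1]/((n + 1)%N : int) addn1 !shift_product_pos.
  by rewrite big_nat_recr //=; congr (_ * (f _)^-1); lia.
have -> : Negz n + 1 = - (n%:Z) by lia.
rewrite NegzE !shift_product_neg [in RHS]big_nat_recr //= -mulrA.
have -> : e + 2 * - n.+1%:Z + 1 = e - (2 * n.+1%:Z - 1) by lia.
by rewrite mulrV // mulr1.
Qed.

(** The chain rule for quotients,
(H(c^(2a+2b) W) / H(c^(2b) W)) * (H(c^(2b) W) / H(W)). *)
Lemma shift_product_cocycle (a b e : int) :
  shift_product (a + b) e = shift_product b e * shift_product a (e + 2 * b).
Proof.
elim/int_rect: a => [|n IHn|n IHn].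
- by rewrite add0r {3}/shift_product big_geq // mulr1.
- have -> : n.+1%:Z + b = (n%:Z + b) + 1 by lia.
  have -> : n.+1%:Z = n%:Z + 1 by lia.
  rewrite !shift_productS IHn mulrA; congr (_ * _ * (f _)^-1); lia.
- set c := - n.+1%:Z in IHn *.
  have en : - n%:Z = c + 1 by rewrite /c; lia.
  move: IHn; rewrite en addrAC !shift_productS mulrA.
  have -> : e + 2 * (c + b) + 1 = e + 2 * b + 2 * c + 1 by lia.
  by apply: mulIr; rewrite unitrV.
Qed.

Lemma shift_product_exchange (a b e : int) :
  shift_product b e * shift_product a (e + 2 * b)
    = shift_product a e * shift_product b (e + 2 * a).
Proof. by rewrite -!shift_product_cocycle addrC. Qed.

Lemma shift_product_comm x (a e : int) :
  (forall e', GRing.comm x (f e')) -> GRing.comm x (shift_product a e).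
Proof. by move=> xf; apply: commr_prod => m _; apply: commrXz. Qed.

Lemma exprz_intertwine (x x' u : R) (a : int) :
    x \is a GRing.unit -> x' \is a GRing.unit ->
  x * u = u * x' -> x ^ a * u = u * x' ^ a.
Proof.
move=> x_unit x'_unit xu.
have xnu n : x ^+ n * u = u * x' ^+ n.
  elim: n => [|n IHn]; first by rewrite mul1r mulr1.
  by rewrite !exprS -mulrA IHn !mulrA xu.
case: a => n; first exact: xnu.
rewrite NegzE -!exprnN; apply: (mulrI (unitrX n.+1 x_unit)).
apply: (mulIr (unitrX n.+1 x'_unit)).
by rewrite !mulrA mulrV ?unitrX // mul1r mulrVK ?unitrX // xnu.
Qed.

(** Moving u through the factors shifts each of them by t, hence shifts the
product by t. *)
Lemma shift_product_intertwine (u : R) (t : int) :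
    (forall e, f e * u = u * f (e + t)) ->
  forall b e, shift_product b e * u = u * shift_product b (e + t).
Proof.
move=> fu b e; rewrite /shift_product.
apply: (big_rec2 (fun x x' => x * u = u * x')) => [|m x x' _ xu].
  by rewrite mul1r mulr1.
rewrite -mulrA xu !mulrA; congr (_ * _).
by apply: exprz_intertwine => //; rewrite fu addrAC.
Qed.

End ShiftProduct.

(** * Commutation up to a power of q *)

Section QCommutation.

Variables (K : fieldType) (q : K) (q_neq0 : q != 0) (A : algType K).
Implicit Types (x y : A) (h : int).

Definition q_commute h x y := x * y = q ^ h *: (y * x).

Lemma q_commute_sym h x y : q_commute h x y -> q_commute (- h) y x.
Proof.
by move=> xy; rewrite /q_commute xy scalerA -expfzDr // addNr scale1r.
Qed.

Lemma q_commute_refl x : q_commute 0 x x.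
Proof. by rewrite /q_commute scale1r. Qed.

Lemma q_commuteMr h1 h2 x y1 y2 :
  q_commute h1 x y1 -> q_commute h2 x y2 -> q_commute (h1 + h2) x (y1 * y2).
Proof.
move=> xy1 xy2; rewrite /q_commute mulrA xy1 -scalerAl.
by rewrite -[y1 * x * y2]mulrA xy2 -scalerAr scalerA -expfzDr // mulrA.
Qed.

Lemma q_commuteMl h1 h2 x1 x2 y :
  q_commute h1 x1 y -> q_commute h2 x2 y -> q_commute (h1 + h2) (x1 * x2) y.
Proof.
move=> x1y x2y; rewrite /q_commute -mulrA x2y -scalerAr.
rewrite [x1 * (y * x2)]mulrA x1y -scalerAl scalerA -expfzDr // mulrA.
by rewrite [h2 + _]addrC.
Qed.

Lemma q_commuteZ h c1 c2 x y :
  q_commute h x y -> q_commute h (c1 *: x) (c2 *: y).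
Proof.
move=> xy; rewrite /q_commute -!scalerAl -!scalerAr xy !scalerA.
by congr (_ *: _); ring.
Qed.

(** For products u p and v t of q-commuting monomials u, v with further factors
p, t that the monomials transform into p', t', moving the monomials to the left
leaves p' t on one side and t' p on the other. *)
Lemma q_commute_tail h u v p p' t t' :
    q_commute h u v -> p * v = v * p' -> t * u = u * t' ->
  p' * t = t' * p -> q_commute h (u * p) (v * t).
Proof.
move=> uv pv tu pt; rewrite /q_commute.
have -> : u * p * (v * t) = u * v * (p' * t).
  by rewrite -!mulrA (mulrA p) pv !mulrA.
have -> : v * t * (u * p) = v * u * (t' * p).
  by rewrite -!mulrA (mulrA t) tu !mulrA.
by rewrite uv pt -scalerAl.
Qed.

End QCommutation.

Lemma q_commuteXl (K : fieldType) (q : K) (A : unitAlgType K) (h a : int)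
    (x y : A) : q != 0 ->
  x \is a GRing.unit -> q_commute q h x y -> q_commute q (a * h) (x ^ a) y.
Proof.
move=> q_neq0 x_unit xy; set c := q ^ h.
have c_unit : c \is a GRing.unit by rewrite unitfE expfz_neq0.
have cX b : (c *: x) ^ b = c ^ b *: x ^ b.
  case: b => n; first by rewrite -!exprnP exprZn.
  by rewrite NegzE -!exprnN exprZn invrZ ?unitrX.
rewrite /q_commute mulrC -exprz_exp scalerAr -cX; apply: exprz_intertwine => //.
  by rewrite scaler_unit.
by rewrite xy scalerAr.
Qed.

(** * Invertibility of the exchange factors *)

Section PowersIndependent.

Variables (K : fieldType) (A : algType K) (f : {lrmorphism A -> A}).
Variables (w : A) (c : K).
Hypothesis fw : f w = c *: w.
Hypothesis c_free : forall m, (0 < m)%N -> c ^+ m != 1.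

(** The powers of w are eigenvectors of f for the distinct eigenvalues c^s.
Applying f - c^(N+1) to a relation of degree N+1 kills its top term and
multiplies its constant term by 1 - c^(N+1), which is nonzero. *)
Lemma const_coef_eq0 (N : nat) (a : nat -> K) :
  \sum_(0 <= s < N.+1) a s *: w ^+ s = 0 -> a 0%N = 0.
Proof.
elim: N a => [|N IHN] a sum0.
  move/eqP: sum0; rewrite big_nat1 expr0 scaler_eq0 oner_eq0 orbF.
  by move/eqP.
pose a' s := a s * (c ^+ s - c ^+ N.+1).
suff /IHN/eqP : \sum_(0 <= s < N.+1) a' s *: w ^+ s = 0.
  rewrite mulf_eq0 expr0 subr_eq0 [1 == _]eq_sym (negPf (c_free _)) // orbF.
  by move/eqP.
have : f (\sum_(0 <= s < N.+2) a s *: w ^+ s)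
       - c ^+ N.+1 *: (\sum_(0 <= s < N.+2) a s *: w ^+ s) = 0.
  by rewrite sum0 raddf0 scaler0 subr0.
rewrite raddf_sum scaler_sumr -sumrB big_nat_recr //= => diff0.
rewrite -[RHS]diff0.
rewrite [X in _ + X](_ : _ = 0) ?addr0; last first.
  by rewrite linearZ rmorphXn /= fw exprZn !scalerA mulrC subrr.
apply: eq_bigr => s _.
rewrite linearZ rmorphXn /= fw exprZn !scalerA -scalerBl /a'; congr (_ *: _).
by ring.
Qed.

End PowersIndependent.

Section QuantumTorus.

Variables (F : fieldType) (n : nat) (d r : 'I_n -> nat) (B : 'M[int]_n).
Local Notation K := (ratfun F).
Local Notation q := (qvar F).

Lemma qvar_neq0 : q != 0.
Proof. by rewrite tofrac_eq0 polyX_eq0. Qed.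

Lemma qvarX_neq1 (m : nat) : (0 < m)%N -> q ^+ m != 1.
Proof.
move=> m_gt0; rewrite /qvar -tofracXn -tofrac1 tofrac_eq.
apply/eqP => /(congr1 (coefp 0)) /=/eqP.
by rewrite coefXn coef1 (ltn_eqF m_gt0) eq_sym oner_eq0.
Qed.

(** The torus relations are homogeneous when y_i and y_i^-1 get degrees 1 and
-1, so the universal property extends y_i |-> c y_i to an endomorphism. *)
Lemma torus_dilation (T : algType K) (y yV : 'I_n -> T) (c : K) :
    c != 0 -> is_quantum_torus d r B y yV ->
  exists f : {lrmorphism T -> T},
    (forall i, f (y i) = c *: y i) /\ (forall i, f (yV i) = c^-1 *: yV i).
Proof.
move=> c_neq0 [[yyV yVy yy] univ].
have rel : torus_relations d r B (fun i => c *: y i) (fun i => c^-1 *: yV i).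
  split=> [i|i|i j].
  - by rewrite -scalerAl -scalerAr scalerA mulfV // scale1r.
  - by rewrite -scalerAl -scalerAr scalerA mulVf // scale1r.
  - exact: (q_commuteZ c c (yy i j)).
have [f [fy _]] := univ T _ _ rel; exists f; split=> // i.
have [cyV _ _] := rel.
by rewrite -[LHS]mulr1 -(cyV i) -fy mulrA -rmorphM yVy rmorph1 mul1r.
Qed.

Variables (D : unitAlgType K) (Y : 'I_n -> D).
Hypothesis seedBY : quantum_Y_seed d r B Y.

Lemma seed_unit (i : 'I_n) : Y i \is a GRing.unit.
Proof.
have [_ [T [y [yV [iota [[[yyV yVy _] _] _ ->]]]]]] := seedBY.
by apply/unitrP; exists (iota (yV i)); rewrite -!rmorphM yyV yVy rmorph1.
Qed.

Lemma seed_q_commute (i j : 'I_n) :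
  q_commute q (2 * (r j * d j)%N%:Z * B j i) (Y i) (Y j).
Proof.
have [_ [T [y [yV [iota [[[_ _ yy] _] _ YE]]]]]] := seedBY.
by rewrite /q_commute !YE -!rmorphM yy [LHS]linearZ /= PoszM !mulrA.
Qed.

Lemma seed_skew (i j : 'I_n) :
  (r i * d i)%N%:Z * B i j = - ((r j * d j)%N%:Z * B j i).
Proof. by have [[_ skew] _] := seedBY. Qed.

(** A relation among the powers of Y_k or of its inverse would already hold in
the torus, where the dilation by q forbids it.  For eps = -1 the relevant
eigenvalues are the powers of q^-1. *)
Lemma seed_sum_unit (k : 'I_n) (eps : int) (N : nat) (a : nat -> K) :
    eps = 1 \/ eps = -1 -> a 0%N != 0 ->
  \sum_(0 <= s < N.+1) a s *: (Y k ^ eps) ^+ s \is a GRing.unit.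
Proof.
move=> eps_sign a0.
have [_ [T [y [yV [iota [torus [D_skew iota_inj _] YE]]]]]] := seedBY.
have [f [fy fyV]] := torus_dilation qvar_neq0 torus.
have [[yyV yVy _] _] := torus.
have qV_neq1 m : (0 < m)%N -> (q^-1) ^+ m != 1.
  by move=> m_gt0; rewrite exprVn invr_eq1 qvarX_neq1.
have [w [c [Yw fw c_free]]] : exists w : T, exists c : K,
    [/\ Y k ^ eps = iota w, f w = c *: w
      & forall m, (0 < m)%N -> c ^+ m != 1].
  case: eps_sign => ->.
    exists (y k), q.
    by split; [rewrite expr1z YE | exact: fy | exact: qvarX_neq1].
  exists (yV k), q^-1; split; [|exact: fyV|exact: qV_neq1].
  rewrite exprN1; apply: (mulrI (seed_unit k)).
  by rewrite mulrV ?seed_unit // YE -rmorphM yyV rmorph1.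
apply: D_skew; apply: contra_neq a0; rewrite Yw => sum0.
apply: (const_coef_eq0 fw c_free (N := N)); apply: iota_inj.
rewrite rmorph0 -sum0 raddf_sum; apply: eq_bigr => s _.
by rewrite [LHS]linearZ /= rmorphXn.
Qed.

End QuantumTorus.

(** * The mutated seed *)

Lemma pos_partM (m : nat) (a : int) : pos_part (m%:Z * a) = m%:Z * pos_part a.
Proof.
rewrite /pos_part; case: m => [|m]; first by rewrite !mul0r ltxx.
by rewrite pmulr_rgt0 //; case: ifP => //; rewrite mulr0.
Qed.

Lemma pos_partB (a : int) : pos_part a - pos_part (- a) = a.
Proof. by rewrite /pos_part; do 2 case: ifP; lia. Qed.

(** Replacing [x]_+ by [-x]_+ = [x]_+ - x changes both terms by a b; this is why
the two choices of the sign eps give the same exponent. *)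
Lemma pos_part_exchange (eps a b : int) : eps = 1 \/ eps = -1 ->
  pos_part (eps * a) * b - a * pos_part (eps * b)
    = pos_part a * b - a * pos_part b.
Proof.
have aE := pos_partB a; have bE := pos_partB b.
case=> ->; first by rewrite !mul1r.
rewrite !mulN1r; move: aE bE.
move: (pos_part a) (pos_part (- a)) => pa na <-.
by move: (pos_part b) (pos_part (- b)) => pb nb <-; ring.
Qed.

Section Mutation.

Variables (F : fieldType) (n : nat) (d r : 'I_n -> nat) (z : 'I_n -> nat -> F).
Variables (D : unitAlgType (ratfun F)) (B : 'M[int]_n) (Y : 'I_n -> D).
Hypothesis seedBY : quantum_Y_seed d r B Y.
Variables (k : 'I_n) (eps : int).
Hypothesis eps_sign : eps = 1 \/ eps = -1.

Local Notation q := (qvar F).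
Local Notation weight i := (r i * d i)%N%:Z.

(** f(c^e W) for c = q_k^(-eps), W = Y_k^eps and f(X) = \sum_s z_{k,s} X^s; the
factor number m of the mutation rule has e = sgn(b_ki) (2m - 1). *)
Definition exchange_factor (e : int) : D :=
  \sum_(0 <= s < (d k).+1)
    (cst (zcoef d z k s) * qi F d r k ^ (- eps * e * s%:Z)) *: (Y k ^ eps) ^+ s.

Lemma qi_exprz (i : 'I_n) (h : int) :
  qi F d r i ^ h = q ^ (weight i * h).
Proof. by rewrite -exprz_exp. Qed.

Lemma mutation_Y_neq (i : 'I_n) : i != k ->
  mutation_Y d r z eps k B Y i
    = qi F d r i ^ (B i k * (d k)%:Z * pos_part (eps * B k i))
       *: (Y i * Y k ^ ((d k)%:Z * pos_part (eps * B k i))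
           * shift_product exchange_factor (B k i) 0).
Proof.
move=> ik; rewrite /mutation_Y (negPf ik); congr (_ *: (_ * _)).
apply: eq_bigr => m _; congr (_ ^ _); apply: eq_bigr => s _.
by rewrite add0r -exprz_exp mulrA.
Qed.

Lemma exchange_factor_unit (e : int) : exchange_factor e \is a GRing.unit.
Proof.
apply: (seed_sum_unit seedBY) => //.
by rewrite mulr0 expr0z mulr1 /cst tofrac1 oner_neq0.
Qed.

(** By hypothesis W u = c^(2b) u W, so f(c^e W) u = u f(c^(e + 2b) W). *)
Lemma exchange_factor_intertwine (b : int) (u : D) :
    q_commute q (- (2 * weight k * b)) (Y k) u ->
  forall e, exchange_factor e * u = u * exchange_factor (e + 2 * b).
Proof.
move=> Yu e; rewrite mulr_suml mulr_sumr; apply: eq_bigr => s _.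
rewrite -scalerAl -scalerAr.
have YXu := q_commuteXl (eps * s%:Z) (qvar_neq0 F) (seed_unit seedBY k) Yu.
rewrite -[_ ^+ s]/(_ ^ s%:Z) !exprz_exp YXu scalerA; congr (_ *: _).
rewrite -[LHS]mulrA !qi_exprz -expfzDr ?qvar_neq0 //; congr (_ * _ ^ _); ring.
Qed.

Lemma exchange_factor_commY (a e : int) :
  GRing.comm (Y k ^ a) (exchange_factor e).
Proof.
apply/commr_sym/commrXz; red.
rewrite (@exchange_factor_intertwine 0) ?mulr0 ?addr0 //.
by rewrite oppr0; apply: q_commute_refl.
Qed.

Lemma exchange_factor_comm (e e' : int) :
  GRing.comm (exchange_factor e) (exchange_factor e').
Proof.
apply: commr_sum => s _; rewrite /GRing.comm -scalerAr -scalerAl.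
congr (_ *: _).
apply: commrX; apply/commr_sym; exact: exchange_factor_commY.
Qed.

(** The right-hand side is the exponent of q produced by the monomials
Y_i Y_k^(a_i) and Y_j Y_k^(a_j) with a_l = d_k [eps b_kl]_+.  The skew-symmetry
of r_i d_i b_ij trades column k of B, which the mutation of B uses, for row k,
which these monomials use. *)
Lemma mutation_B_weighted (i j : 'I_n) : i != k -> j != k ->
  2 * weight j * mutation_B d k B j i
    = 2 * (weight j * B j i
           + weight k * ((d k)%:Z * pos_part (eps * B k j) * B k i
                         - B k j * ((d k)%:Z * pos_part (eps * B k i)))).
Proof.
move=> ik jk; rewrite mxE (negPf ik) (negPf jk) /= -mulrA; congr (2 * _).
have skew := seed_skew seedBY j k.
have pos_skew : weight j * pos_part (- B j k) = weight k * pos_part (B k j).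
  by rewrite -!pos_partM mulrN skew opprK.
transitivity (weight j * B j i
    + (d k)%:Z * (weight j * pos_part (- B j k) * B k i
                  + weight j * B j k * pos_part (B k i))); first by ring.
rewrite skew pos_skew.
transitivity (weight j * B j i + weight k * (d k)%:Z *
    (pos_part (eps * B k j) * B k i - B k j * pos_part (eps * B k i))).
  by rewrite pos_part_exchange //; ring.
by ring.
Qed.

Lemma mutation_q_commute_neq (i j : 'I_n) : i != k -> j != k ->
  q_commute q (2 * weight j * mutation_B d k B j i)
    (mutation_Y d r z eps k B Y i) (mutation_Y d r z eps k B Y j).
Proof.
move=> ik jk; rewrite !mutation_Y_neq //; apply: q_commuteZ.
set a := fun i => (d k)%:Z * pos_part (eps * B k i).
rewrite -/(a i) -/(a j).
have Yk_unit := seed_unit seedBY k.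
have q0 := qvar_neq0 F.
have Y_q := seed_q_commute seedBY.
have YkY l : q_commute q (- (2 * weight k * B k l)) (Y k) (Y l).
  have -> : - (2 * weight k * B k l) = 2 * weight l * B l k.
    by rewrite -!mulrA (seed_skew seedBY k l) mulrN opprK.
  exact: seed_q_commute.
(* The extra factor Y_k^(a_l) of U_l commutes with Y_k. *)
have YkU l : q_commute q (- (2 * weight k * B k l)) (Y k) (Y l * Y k ^ a l).
  rewrite -[X in q_commute _ X]addr0; apply: q_commuteMr => //.
  rewrite -oppr0; apply: q_commute_sym => //.
  rewrite -(mulr0 (a l)); apply: q_commuteXl => //; exact: q_commute_refl.
set P := shift_product exchange_factor.
have PU m l e : P (B k m) e * (Y l * Y k ^ a l)
                = Y l * Y k ^ a l * P (B k m) (e + 2 * B k l).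
  apply: shift_product_intertwine; first exact: exchange_factor_unit.
  exact: exchange_factor_intertwine.
have PP b c e e' : GRing.comm (P b e) (P c e').
  apply: shift_product_comm => e1; apply/commr_sym; apply: shift_product_comm.
  exact: exchange_factor_comm.
have UU : q_commute q (2 * weight j * mutation_B d k B j i)
            (Y i * Y k ^ a i) (Y j * Y k ^ a j).
  rewrite mutation_B_weighted //.
  have -> : 2 * (weight j * B j i + weight k * (a j * B k i - B k j * a i))
      = (2 * weight j * B j i + - (a j * - (2 * weight k * B k i)))
        + a i * - (2 * weight k * B k j) by ring.
  apply: q_commuteMl => //; last exact: q_commuteXl.
  apply: q_commuteMr => //.
  by apply: q_commute_sym => //; apply: q_commuteXl.
apply: q_commute_tail UU (PU i j 0) (PU j i 0) _.
transitivity (P (B k j) 0 * P (B k i) (0 + 2 * B k j)); first exact: PP.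
transitivity (P (B k i) 0 * P (B k j) (0 + 2 * B k i)); last exact: PP.
exact: (shift_product_exchange exchange_factor_unit).
Qed.

(** When one of the indices is k, only the monomial part of the other variable
contributes, and the sign change of row and column k of B matches the inversion
of Y_k. *)
Lemma mutation_q_commute (i j : 'I_n) :
  q_commute q (2 * weight j * mutation_B d k B j i)
    (mutation_Y d r z eps k B Y i) (mutation_Y d r z eps k B Y j).
Proof.
have Yk_unit := seed_unit seedBY k.
have mutk : mutation_Y d r z eps k B Y k = (Y k)^-1 by rewrite /mutation_Y eqxx.
have kl l : l != k -> q_commute q (2 * weight l * mutation_B d k B l k)
    (mutation_Y d r z eps k B Y k) (mutation_Y d r z eps k B Y l).
  have q0 := qvar_neq0 F.
  move=> lk; rewrite mutk mutation_Y_neq // mxE eqxx orbT.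
  rewrite -[(Y k)^-1]scale1r; apply: q_commuteZ.
  rewrite -[X in q_commute _ X]addr0; apply: q_commuteMr; first exact: q0.
    rewrite -[X in q_commute _ X]addr0; apply: q_commuteMr; first exact: q0.
      rewrite mulrN -mulN1r -exprN1.
      apply: q_commuteXl => //; exact: seed_q_commute.
    rewrite /q_commute scale1r; apply/commr_sym; apply: commrV; apply/commr_sym.
    exact: commrXz.
  rewrite /q_commute scale1r; apply: shift_product_comm => e.
  rewrite -exprN1; exact: exchange_factor_commY.
have [-> | ik] := eqVneq i k; last have [-> | jk] := eqVneq j k.
- have [-> | jk] := eqVneq j k; last exact: kl.
  have skew := seed_skew seedBY k k.
  have -> : 2 * weight k * mutation_B d k B k k = 0 by rewrite mxE eqxx /=; lia.
  exact: q_commute_refl.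
- have -> : 2 * weight k * mutation_B d k B k i
            = - (2 * weight i * mutation_B d k B i k).
    rewrite !mxE eqxx orbT /= !mulrN opprK -!mulrA (seed_skew seedBY k i).
    by rewrite mulrN opprK.
  by apply: q_commute_sym; [exact: qvar_neq0 | exact: kl].
exact: mutation_q_commute_neq.
Qed.

End Mutation.

Theorem proposition3p5 (F : fieldType) (n : nat) (d r : 'I_n -> nat)
    (z : 'I_n -> nat -> F) (D : unitAlgType (ratfun F))
    (B : 'M[int]_n) (Y : 'I_n -> D)
    (d_gt0 : forall i, (0 < d i)%N) (r_gt0 : forall i, (0 < r i)%N)
    (z_rec : reciprocal d z)
    (seedBY : quantum_Y_seed d r B Y)
    (k : 'I_n) (eps : int) (eps_sign : eps = 1 \/ eps = -1)
    (B' : 'M[int]_n) (Y' : 'I_n -> D)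
    (mutBY : (B', Y') = mutation d r z eps k (B, Y)) :
  forall i j : 'I_n,
    Y' i * Y' j
      = (qvar F ^ (2 * (r j)%:Z * (d j)%:Z * B' j i)) *: (Y' j * Y' i).
Proof.
case: mutBY => -> -> i j.
have := mutation_q_commute z seedBY k eps_sign i j.
by rewrite /q_commute PoszM mulrA.
Qed.
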